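(* Let $K_s=\operatorname{sym}K_{ff}(k,a)$ and $K_a=\operatorname{anti}K_{ff}(k,a)$, so that $K_s$ is $K_{ff}(k,0)$ plus the restriction to the free degrees of freedom of $\tfrac12\sum_ba_b(s_bq_b^{T}+q_bs_b^{T})$, and suppose $K_s\succ0$. Then $K_{ff}$ is invertible, and with $C=K_{ff}^{-1}$ and $C_P=C[P,P]$ one has $\operatorname{sym}C_P\succ0$ and $$\eta(C_P)\;\le\;\eta(K_{ff})\;=\;\bigl\|K_s^{-1/2}K_aK_s^{-1/2}\bigr\|_2,$$ with equality when $P$ is the whole set of free degrees of freedom. In particular every such network (with $K_s\succ0$) whose shared block $C_P$ equals a target $B\in\mathbb{R}^{p\times p}$ has $\eta(K_{ff})\ge\eta(B)$.
   Context: Network: $N$ point nodes at positions $x_i\in\mathbb{R}^2$ are joined by $n_b$ bonds. For a bond $b=(i,j)$ of length $L_b=|x_j-x_i|>0$ let $\hat n_b=(x_j-x_i)/L_b$ and let $\hat t_b$ be $\hat n_b$ rotated by $+90^\circ$. The vector $q_b\in\mathbb{R}^{2N}$ carries $-\hat n_b$ at node $i$, $+\hat n_b$ at node $j$, zeros elsewhere; $s_b$ is the same with $\hat t_b$. For stiffnesses $k=(k_b)$, $k_b>0$, and odd couplings $a=(a_b)\in\mathbb{R}^{n_b}$, $K=\sum_b(k_bq_b+a_bs_b)q_b^{T}$. Three degrees of freedom are pinned to remove the planar rigid-body modes and $K_{ff}(k,a)$ is the restriction of $K$ to the remaining $n_{\mathrm{free}}=2N-3$ free ones. $P$ is a set of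 $p$ free degrees of freedom (those both driven and read). For a real square matrix $Z$, $\operatorname{sym}Z=\tfrac12(Z+Z^{T})$, $\operatorname{anti}Z=\tfrac12(Z-Z^{T})$, and when $\operatorname{sym}Z\succ0$, $\eta(Z)=\|(\operatorname{sym}Z)^{-1/2}(\operatorname{anti}Z)(\operatorname{sym}Z)^{-1/2}\|_2$ (spectral norm). *)

(* Defs.v *)
From HB Require Import structures.
From mathcomp Require Import all_boot all_order all_algebra.
From mathcomp Require Import all_classical all_reals.

Set Implicit Arguments.
Unset Strict Implicit.
Unset Printing Implicit Defensive.

Import Order.TTheory GRing.Theory Num.Theory.
Local Open Scope ring_scope.

Definition enorm (R : realType) (n : nat) (v : 'cV[R]_n) : R :=
  Num.sqrt (\sum_i v i 0 ^+ 2).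

(* The matrix norm subordinate to [enorm]; using the closed unit ball rather
   than the unit sphere keeps the set nonempty when [n = 0]. *)
Definition specnorm (R : realType) (n : nat) (Z : 'M[R]_n) : R :=
  sup [set enorm (Z *m v) | v in [set v : 'cV[R]_n | enorm v <= 1]]%classic.

Definition symp (R : realType) (n : nat) (Z : 'M[R]_n) : 'M[R]_n :=
  2^-1 *: (Z + Z^T).

Definition antip (R : realType) (n : nat) (Z : 'M[R]_n) : 'M[R]_n :=
  2^-1 *: (Z - Z^T).

Definition posdefmx (R : realType) (n : nat) (A : 'M[R]_n) : Prop :=
  A^T = A /\ forall v : 'cV[R]_n, v != 0 -> 0 < (v^T *m A *m v) 0 0.

(* [A^(-1/2)]: the positive definite [S] with [S^2 = A^-1]. It exists and is
   unique whenever [A] is positive definite; otherwise the value is the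
   default 0. *)
Definition invsqrtmx (R : realType) (n : nat) (A : 'M[R]_n) : 'M[R]_n :=
  xget 0 [set S : 'M[R]_n | posdefmx S /\ S *m S = invmx A]%classic.

(* Meaningful only when [symp Z] is positive definite. *)
Definition eta (R : realType) (n : nat) (Z : 'M[R]_n) : R :=
  specnorm (invsqrtmx (symp Z) *m antip Z *m invsqrtmx (symp Z)).

(* [A[S, S]], rows and columns in increasing index order. The size is a
   separate parameter so that matrices of a prescribed size can be compared
   with blocks of different matrices. *)
Definition block (R : realType) (n p : nat) (S : {set 'I_n}) (hS : #|S| = p)
    (A : 'M[R]_n) : 'M[R]_p :=
  let f (i : 'I_p) : 'I_n := enum_val (cast_ord (esym hS) i) in
  mxsub f f A.

Record network (R : realType) (N nb : nat) := Network {
  pos : 'I_N -> 'cV[R]_2;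
  src : 'I_nb -> 'I_N;
  tgt : 'I_nb -> 'I_N;
  bond_len_gt0 : forall b, 0 < enorm (pos (tgt b) - pos (src b)) }.

Definition rot90 (R : realType) (v : 'cV[R]_2) : 'cV[R]_2 :=
  \col_c (if c == 0 then - v 1 0 else v 0 0).

(* A nodal field in [R^(2N)]: degree of freedom [mxvec_index m c] is
   coordinate [c] at node [m]. *)
Definition nodal (R : realType) (N : nat) (u : 'I_N -> 'cV[R]_2) :
    'cV[R]_(N * 2) :=
  (mxvec (\matrix_(m < N, c < 2) u m c 0))^T.

Section Network.
Variables (R : realType) (N nb : nat) (G : network R N nb).

Definition bond_len (b : 'I_nb) : R := enorm (pos G (tgt G b) - pos G (src G b)).

Definition nhat (b : 'I_nb) : 'cV[R]_2 :=
  (bond_len b)^-1 *: (pos G (tgt G b) - pos G (src G b)).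

Definition that (b : 'I_nb) : 'cV[R]_2 := rot90 (nhat b).

(* [- w] at the source of [b], [+ w] at its target (these are distinct nodes,
   the length being positive), 0 elsewhere. *)
Definition bond_vec (b : 'I_nb) (w : 'cV[R]_2) : 'cV[R]_(N * 2) :=
  nodal (fun m => ((m == tgt G b)%:R - (m == src G b)%:R) *: w).

Definition qvec (b : 'I_nb) := bond_vec b (nhat b).
Definition svec (b : 'I_nb) := bond_vec b (that b).

Definition stiffness (k a : 'I_nb -> R) : 'M[R]_(N * 2) :=
  \sum_b (k b *: qvec b + a b *: svec b) *m (qvec b)^T.

(* Infinitesimal planar rigid motion: translation [tau], angular velocity
   [omega] about the origin. *)
Definition rigid_mode (tau : 'cV[R]_2) (omega : R) : 'cV[R]_(N * 2) :=
  nodal (fun m => tau + omega *: rot90 (pos G m)).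

Definition removes_rigid (pinned : {set 'I_(N * 2)}) : Prop :=
  forall tau omega,
    (forall d, d \in pinned -> rigid_mode tau omega d 0 = 0) ->
    rigid_mode tau omega = 0.

End Network.

Lemma card_free (N : nat) (pinned : {set 'I_(N * 2)}) :
  #|pinned| = 3%N -> #|(~: pinned)%SET| = (2 * N - 3)%N.
Proof.
move=> h; have := cardsC pinned; rewrite card_ord h => e.
by rewrite -(addKn 3 #|_|) e; congr (_ - _)%N; exact: mulnC.
Qed.

Definition restrict_free (R : realType) (N : nat) (pinned : {set 'I_(N * 2)})
    (hpin : #|pinned| = 3%N) (A : 'M[R]_(N * 2)) : 'M[R]_(2 * N - 3) :=
  block (card_free hpin) A.

(* Main.v *)
(* For c >= 0, substituting x = (sym Z)^(-1/2) v shows that eta(Z) <= c iff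
     2 y^T (anti Z) x <= c (x^T Z x + y^T Z y)   for all x, y.
   This property passes from Z to X^T Z^T X for every injective X. The shared
   block is such a congruence: with Q the inclusion of the coordinates of P and
   C = Z^-1, one has C = C^T Z^T C, hence C_P = (C Q)^T Z^T (C Q). When P is
   everything Q is invertible, so Z is conversely a congruence of C_P^T. The
   square root comes from interpolating x^(1/4) on the real spectrum. *)
Require Import Defs.
From mathcomp Require Import all_boot all_order all_algebra.
From mathcomp Require Import all_classical all_reals.
From mathcomp Require Import complex ring lra.

Set Implicit Arguments.
Unset Strict Implicit.
Unset Printing Implicit Defensive.

Import Order.TTheory GRing.Theory Num.Theory.
Local Open Scope ring_scope.

(** * Interpolation and the real spectrum of a symmetric matrix *)

Lemma interpolation (F : fieldType) (f : F -> F) (s : seq F) :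
  exists p : {poly F}, forall x, x \in s -> p.[x] = f x.
Proof.
elim: s => [|x s [p hp]]; first by exists 0.
have [xs|xs] := boolP (x \in s).
  by exists p => y; rewrite inE => /predU1P[->|]; exact: hp.
(* Newton's correction: [w] vanishes at the old nodes and not at [x]. *)
pose w := \prod_(z <- s) ('X - z%:P).
have wx : w.[x] != 0 by rewrite -[_ == 0]/(root w x) root_prod_XsubC.
exists (p + ((f x - p.[x]) / w.[x]) *: w) => y; rewrite hornerD hornerZ inE.
case/predU1P=> [->|ys]; first by rewrite divfK // addrC subrK.
by have /rootP-> : root w y; rewrite ?root_prod_XsubC// mulr0 addr0 hp.
Qed.

Lemma trmx_horner_mx (F : comNzRingType) n (A : 'M[F]_n.+1) (p : {poly F}) :
  (horner_mx A p)^T = horner_mx A^T p.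
Proof.
elim/poly_ind: p => [|p c IH]; first by rewrite !rmorph0 trmx0.
rewrite !rmorphD !rmorphM /= !horner_mx_X !horner_mx_C linearD /=.
by rewrite tr_scalar_mx -mulmxE trmx_mul IH; congr (_ + _); exact: comm_mx_horner.
Qed.

Lemma horner_mx_diagonalized (F : fieldType) n (U : 'M[F]_n.+1) (D : 'rV[F]_n.+1)
    (p : {poly F}) : U \in unitmx ->
  horner_mx (invmx U *m diag_mx D *m U) p =
    invmx U *m diag_mx (map_mx (horner p) D) *m U.
Proof. by move=> Uu; rewrite horner_mx_uconjC // horner_mx_diag. Qed.

(** Viewed over [R[i]] the matrix is Hermitian, hence unitarily diagonalizable with real
    eigenvalues. A polynomial vanishing at these kills the diagonal factor, and injectivity of the
    embedding brings the conclusion back to [R]. *)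
Lemma symmetric_spectrum (R : rcfType) n (A : 'M[R]_n.+1) : A^T = A ->
  exists d : 'I_n.+1 -> R, (forall i, eigenvalue A (d i)) /\
    forall p : {poly R}, (forall i, p.[d i] = 0) -> horner_mx A p = 0.
Proof.
move=> symA; pose f := real_complex R; pose B := map_mx f A.
have hermB : B \is hermsymmx.
  apply/is_hermitianmxP; rewrite expr0 scale1r; apply/matrixP => i j.
  by rewrite !mxE -[in LHS]symA mxE /= -[RHS]/(conjc _) conjc_real.
have realB := hermitian_spectral_diag_real hermB.
have /orthomx_spectralP := hermitian_normalmx hermB.
set U := spectralmx B; set D := spectral_diag B => eqB.
have Uu : U \in unitmx by exact: unitarymx_unit (spectral_unitarymx B).
have hD i : D 0 i = f (complex.Re (D 0 i)).
  have /mxOverP/(_ 0 i) := realB.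
  by case: (D 0 i) => x y; rewrite complex_real => /eqP /= ->.
have hornB (p : {poly R[i]}) :
    horner_mx B p = invmx U *m diag_mx (map_mx (horner p) D) *m U.
  exact: etrans (congr1 (horner_mx^~ p) eqB) (horner_mx_diagonalized D p Uu).
exists (fun i => complex.Re (D 0 i)); split=> [i|p p0].
  (* Being an eigenvalue descends from [B] to [A] because the characteristic polynomial commutes
     with the embedding; row [i] of [U] is an eigenvector of [B], nonzero since [U] is
     invertible. *)
  rewrite eigenvalue_root_char -(fmorph_root f) -[X in root _ X]/(f _) -hD map_char_poly.
  rewrite -eigenvalue_root_char; apply/eigenvalueP; exists (row i U).
    rewrite -/B eqB -row_mul !mulmxA mulmxV // mul1mx.
    by rewrite row_mul row_diag_mx -scalemxAl rowE.
  apply: contraTneq Uu => Ui0; rewrite -row_free_unit.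
  by apply/row_freePn; exists i; rewrite Ui0 sub0mx.
apply: (map_mx_inj (f := f)); rewrite map_horner_mx hornB.
rewrite [map_mx (horner _) D](_ : _ = 0) ?linear0 ?mulmx0 ?mul0mx ?map_mx0//.
by apply/rowP => i; rewrite !mxE hD horner_map p0 rmorph0.
Qed.

(** * Transposes, quadratic forms and the Euclidean norm *)

Lemma trmxD (V : zmodType) m n (A B : 'M[V]_(m, n)) : (A + B)^T = A^T + B^T.
Proof. by apply/matrixP => i j; rewrite !mxE. Qed.

Lemma trmxN (V : zmodType) m n (A : 'M[V]_(m, n)) : (- A)^T = - A^T.
Proof. by apply/matrixP => i j; rewrite !mxE. Qed.

Lemma trmxB (V : zmodType) m n (A B : 'M[V]_(m, n)) : (A - B)^T = A^T - B^T.
Proof. by apply/matrixP => i j; rewrite !mxE. Qed.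

Lemma trmxZ (R : pzRingType) m n c (A : 'M[R]_(m, n)) : (c *: A)^T = c *: A^T.
Proof. by apply/matrixP => i j; rewrite !mxE. Qed.

Lemma quad_tr (R : comNzRingType) n (A : 'M[R]_n) (u v : 'cV[R]_n) :
  (u^T *m A *m v) 0 0 = (v^T *m A^T *m u) 0 0.
Proof.
transitivity ((u^T *m A *m v)^T 0 0); first by rewrite [RHS]mxE.
by rewrite !trmx_mul trmxK mulmxA.
Qed.

Lemma enorm_ge0 (R : realType) n (v : 'cV[R]_n) : 0 <= enorm v.
Proof. exact: sqrtr_ge0. Qed.

Lemma sqr_enorm (R : realType) n (v : 'cV[R]_n) : enorm v ^+ 2 = (v^T *m v) 0 0.
Proof.
rewrite sqr_sqrtr ?sumr_ge0// => [|i _]; last exact: sqr_ge0.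
by rewrite mxE; apply: eq_bigr => i _; rewrite mxE expr2.
Qed.

Lemma enorm_eq0 (R : realType) n (v : 'cV[R]_n) : (enorm v == 0) = (v == 0).
Proof.
apply/eqP/eqP => [|->]; last first.
  by apply/eqP; rewrite -sqrf_eq0 sqr_enorm mulmx0 mxE.
move/eqP; rewrite -sqrf_eq0 sqr_enorm mxE psumr_eq0 => [|i _]; last first.
  by rewrite mxE -expr2 sqr_ge0.
move/allP => v0; apply/colP => i; rewrite [RHS]mxE; apply/eqP.
by have := v0 i (mem_index_enum _); rewrite mxE mulf_eq0 orbb.
Qed.

Lemma enorm0 (R : realType) n : enorm (0 : 'cV[R]_n) = 0.
Proof. by apply/eqP; rewrite enorm_eq0. Qed.

Lemma enorm_gt0 (R : realType) n (v : 'cV[R]_n) : (0 < enorm v) = (v != 0).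
Proof. by rewrite lt0r enorm_ge0 andbT enorm_eq0. Qed.

(** * Positive definite matrices and their square roots *)

Lemma unitmx_injP (F : fieldType) n (A : 'M[F]_n) :
  (forall v : 'cV[F]_n, A *m v = 0 -> v = 0) -> A \in unitmx.
Proof.
move=> injA; rewrite -unitmx_tr -row_free_unit -kermx_eq0; apply/eqP/row_matrixP => i.
rewrite row0; apply: trmx_inj; rewrite trmx0; apply: injA.
by apply: trmx_inj; rewrite trmx_mul trmxK trmx0 -row_mul mulmx_ker row0.
Qed.

Lemma posdefmx_unit (R : realType) n (A : 'M[R]_n) : posdefmx A -> A \in unitmx.
Proof.
case=> _ posA; apply: unitmx_injP => v Av0; apply/eqP/negPn/negP => /posA.
by rewrite -mulmxA Av0 mulmx0 mxE ltxx.
Qed.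

Lemma posdefmx_congr (R : realType) n m (A : 'M[R]_n) (X : 'M[R]_(n, m)) :
  (forall v : 'cV[R]_m, X *m v = 0 -> v = 0) ->
  posdefmx A -> posdefmx (X^T *m A *m X).
Proof.
move=> injX [symA posA]; split=> [|v v0].
  by rewrite !trmx_mul symA trmxK mulmxA.
have /posA : X *m v != 0 by apply: contraNneq v0 => /injX ->.
by rewrite trmx_mul !mulmxA.
Qed.

Lemma posdefmx_inv (R : realType) n (A : 'M[R]_n) : posdefmx A -> posdefmx (invmx A).
Proof.
move=> pdA; have Au := posdefmx_unit pdA; case: (pdA) => symA _.
have -> : invmx A = (invmx A)^T *m A *m invmx A.
  by rewrite trmx_inv symA mulVmx // mul1mx.
by apply: posdefmx_congr => // v /(congr1 (mulmx A)); rewrite mulKVmx // mulmx0.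
Qed.

(* A fourth root [T] is taken rather than a square root: [T *m T] is then
   positive definite for free. *)
Lemma posdefmx_sqrt (R : realType) n (A : 'M[R]_n) : posdefmx A ->
  exists2 S : 'M[R]_n, posdefmx S & S *m S = A.
Proof.
(* [horner_mx] needs a size of the form [n.+1]; in size 0 all matrices are equal, so [A] is its own
   root. *)
case: n A => [|n] A pdA.
  exists A; first exact: pdA.
  by apply/matrixP; case.
have [symA posA] := pdA.
have [d [eigd horner0]] := symmetric_spectrum symA.
have d_gt0 i : 0 < d i.
  have /eigenvalueP[v vA v0] := eigd i.
  have vT0 : v^T != 0 by rewrite -trmx0 (inj_eq trmx_inj).
  have := posA _ vT0; rewrite trmxK vA -scalemxAl mxE -{1}[v]trmxK -sqr_enorm.
  by rewrite pmulr_lgt0 // exprn_gt0 // enorm_gt0.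
have [p hp] := interpolation (fun x => Num.sqrt (Num.sqrt x)) (codom d).
pose T := horner_mx A p.
have symT : T^T = T by rewrite trmx_horner_mx symA.
have T4 : T *m T *m (T *m T) = A.
  (* [p ^+ 4 - 'X] vanishes on the spectrum, so it annihilates [A]. *)
  apply/eqP; rewrite -subr_eq0 -[X in _ - X](horner_mx_X A) !mulmxE.
  rewrite -!rmorphM -rmorphB /=.
  apply/eqP/horner0 => i; rewrite hornerD hornerN hornerX !hornerM hp ?codom_f //.
  have sqrtK (x : R) : 0 <= x -> Num.sqrt x * Num.sqrt x = x.
    by rewrite -expr2; exact: sqr_sqrtr.
  by rewrite !sqrtK ?sqrtr_ge0 // ?subrr // ltW.
exists (T *m T) => //; split=> [|v v0]; first by rewrite trmx_mul symT.
rewrite -{1}symT mulmxA -trmx_mul -mulmxA -sqr_enorm exprn_gt0 // enorm_gt0.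
(* If [T v = 0], then [v = A^-1 T^4 v = 0]. *)
apply: contraNneq v0 => Tv0.
have Au := posdefmx_unit pdA.
by rewrite -[v](mulKmx Au) -{2}T4 -!mulmxA Tv0 !mulmx0.
Qed.

(** Existence of a root of [invmx A] ensures that [xget] does not fall back on its default 0. *)
Lemma invsqrtmxP (R : realType) n (A : 'M[R]_n) : posdefmx A ->
  posdefmx (invsqrtmx A) /\ invsqrtmx A *m invsqrtmx A = invmx A.
Proof.
move=> /posdefmx_inv/posdefmx_sqrt[S pdS S2].
exact: (xgetPex 0 (P := [set S : 'M[R]_n | posdefmx S /\ S *m S = invmx A]%classic)
  (ex_intro _ S (conj pdS S2))).
Qed.

(** * The spectral norm and the Cauchy-Schwarz inequality *)

Lemma enorm_mulmx_bounded (R : realType) n (M : 'M[R]_n) :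
  has_ubound [set enorm (M *m v) | v in [set v : 'cV[R]_n | enorm v <= 1]]%classic.
Proof.
(* In the unit ball every coordinate of [v] has modulus at most 1, so each entry of [M *m v] is
   bounded by the absolute sum of its row. *)
exists (Num.sqrt (\sum_i (\sum_j `|M i j|) ^+ 2)) => _ [v /= v1 <-].
rewrite ler_wsqrtr // ler_sum // => i _.
rewrite -[leLHS]real_normK ?num_real // lerXn2r ?nnegrE ?sumr_ge0 // mxE.
apply: le_trans (ler_norm_sum _ _ _) _; apply: ler_sum => j _.
rewrite normrM ler_piMr //.
have : enorm v ^+ 2 <= 1 by rewrite expr_le1 ?enorm_ge0.
rewrite sqr_enorm mxE (bigD1 j) //= mxE -expr2 => vj1.
rewrite -(@expr_le1 _ 2) // real_normK ?num_real //; apply: le_trans vj1.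
by rewrite lerDl sumr_ge0 // => k _; rewrite mxE -expr2 sqr_ge0.
Qed.

Lemma specnorm_ge0 (R : realType) n (M : 'M[R]_n) : 0 <= specnorm M.
Proof.
apply: le_trans (enorm_ge0 (M *m 0)) _; apply: ub_le_sup.
  exact: enorm_mulmx_bounded.
by exists 0 => //=; rewrite enorm0.
Qed.

Lemma dot_le_enorm (R : realType) n (u v : 'cV[R]_n) :
  (u^T *m v) 0 0 <= enorm u * enorm v.
Proof.
have [->|u0] := eqVneq u 0; first by rewrite trmx0 mul0mx mxE mulr_ge0 ?enorm_ge0.
have [->|v0] := eqVneq v 0; first by rewrite mulmx0 mxE mulr_ge0 ?enorm_ge0.
have uv_gt0 : 0 < enorm u * enorm v by rewrite mulr_gt0 ?enorm_gt0.
have vu : (v^T *m u) 0 0 = (u^T *m v) 0 0.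
  by rewrite -[v^T]mulmx1 quad_tr trmx1 mulmx1.
(* This square expands to [2 |u| |v| (|u| |v| - u^T v)]; dividing by the positive factor gives the
   claim. *)
have : 0 <= enorm (enorm v *: u - enorm u *: v) ^+ 2 by exact: sqr_ge0.
rewrite sqr_enorm trmxB !trmxZ mulmxBl !mulmxBr -!scalemxAl -!scalemxAr !scalerA.
have mxB (x y : 'M[R]_1) : (x - y) 0 0 = x 0 0 - y 0 0 by rewrite !mxE.
have mxZ c (x : 'M[R]_1) : (c *: x) 0 0 = c * x 0 0 by rewrite !mxE.
rewrite !mxB !mxZ -!sqr_enorm vu => h.
rewrite -subr_ge0 -(pmulr_rge0 _ uv_gt0); lra.
Qed.

Lemma enormZ (R : realType) n (c : R) (v : 'cV[R]_n) :
  0 <= c -> enorm (c *: v) = c * enorm v.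
Proof.
move=> c0; apply/eqP; rewrite -(@eqrXn2 _ 2) ?mulr_ge0 ?enorm_ge0 //.
rewrite exprMn !sqr_enorm trmxZ -scalemxAl -scalemxAr scalerA -expr2.
by apply/eqP; rewrite mxE.
Qed.

Lemma enorm_mulmx_le (R : realType) n (M : 'M[R]_n) (v : 'cV[R]_n) :
  enorm (M *m v) <= specnorm M * enorm v.
Proof.
have [->|v0] := eqVneq v 0; first by rewrite mulmx0 enorm0 mulr0.
have vgt0 : 0 < enorm v by rewrite enorm_gt0.
rewrite -ler_pdivrMr // mulrC -enormZ ?invr_ge0 ?enorm_ge0 // scalemxAr.
apply: ub_le_sup; first exact: enorm_mulmx_bounded.
exists ((enorm v)^-1 *: v) => //=.
by rewrite enormZ ?invr_ge0 ?enorm_ge0 // mulVf // gt_eqF.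
Qed.

(** * Bounds on [eta] as inequalities between quadratic forms *)

Lemma quad_symp (R : realType) n (Z : 'M[R]_n) (x : 'cV[R]_n) :
  (x^T *m symp Z *m x) 0 0 = (x^T *m Z *m x) 0 0.
Proof.
rewrite /symp -scalemxAr -scalemxAl mulmxDr mulmxDl mxE [X in 2^-1 * X]mxE.
by rewrite -quad_tr; lra.
Qed.

(** With [T] the inverse of [S], [|T x|^2] equals [x^T Z x], so both sides can be read in the
    coordinates [T x], [T y]. No square root remains in the criterion, which makes it easy to
    transport along a congruence. *)
Lemma eta_leP (R : realType) n (Z : 'M[R]_n) (c : R) :
  posdefmx (symp Z) -> 0 <= c ->
  (eta Z <= c <-> forall x y : 'cV[R]_n,
    2 * (y^T *m antip Z *m x) 0 0
      <= c * ((x^T *m Z *m x) 0 0 + (y^T *m Z *m y) 0 0)).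
Proof.
move=> pdH c0; have [pdS S2] := invsqrtmxP pdH.
rewrite /eta; set S := invsqrtmx _ in pdS S2 *; set W := antip Z.
have Su := posdefmx_unit pdS; have [symS _] := pdS.
pose T := invmx S.
have symT : T^T = T by rewrite trmx_inv symS.
have TT : T *m T = symp Z.
  rewrite -[LHS](mulmxKV (posdefmx_unit pdH)) -S2 mulmxA mulmxKV //.
  by rewrite mulVmx // mul1mx.
have normT x : enorm (T *m x) ^+ 2 = (x^T *m Z *m x) 0 0.
  by rewrite sqr_enorm trmx_mul symT -quad_symp -TT !mulmxA.
split=> [etac x y|hc].
- rewrite -!normT.
  have -> : y^T *m W *m x = (T *m y)^T *m (S *m W *m S *m (T *m x)).
    by rewrite trmx_mul symT !mulmxA mulmxKV // mulmxK.
  have le1 := dot_le_enorm (T *m y) (S *m W *m S *m (T *m x)).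
  have le2 := enorm_mulmx_le (S *m W *m S) (T *m x).
  have le3 : enorm (S *m W *m S *m (T *m x)) <= c * enorm (T *m x).
    by apply: le_trans le2 _; rewrite ler_wpM2r ?enorm_ge0.
  have le4 : (((T *m y)^T *m (S *m W *m S *m (T *m x))) 0 0)
      <= enorm (T *m y) * (c * enorm (T *m x)).
    by apply: le_trans le1 _; rewrite ler_wpM2l ?enorm_ge0.
  (* Cauchy-Schwarz bounds the left side by [2 c |T x| |T y|]; this square supplies
     [2 |T x| |T y| <= |T x|^2 + |T y|^2]. *)
  have := mulr_ge0 c0 (sqr_ge0 (enorm (T *m x) - enorm (T *m y))).
  move: le4; set q := (_ 0 0); set e := enorm (T *m y); set f := enorm (T *m x).
  by rewrite -subr_ge0 => le4 sq; lra.
- apply: ge_sup.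
    by exists (enorm (S *m W *m S *m 0)), 0 => //=; rewrite enorm0.
  move=> _ [v /= v1 <-]; set w := _ *m v.
  have [->|w0] := eqVneq w 0; first by rewrite enorm0.
  have wgt0 : 0 < enorm w by rewrite enorm_gt0.
  (* The unit vector along [w] makes [u^T w = |w|]. Testing with [S v] and [S u] yields
     [2 |w| <= c (|v|^2 + 1) <= 2 c]. *)
  pose u := (enorm w)^-1 *: w.
  have u1 : enorm u = 1.
    by rewrite enormZ ?invr_ge0 ?enorm_ge0 // mulVf // gt_eqF.
  have := hc (S *m v) (S *m u); rewrite -!normT !mulKmx // u1.
  have -> : ((S *m u)^T *m W *m (S *m v)) 0 0 = enorm w.
    rewrite trmx_mul symS !mulmxA -!(mulmxA u^T) -/w trmxZ -scalemxAl mxE.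
    by rewrite -sqr_enorm expr2 mulrA mulVf ?mul1r // gt_eqF.
  have : enorm v ^+ 2 <= 1 by rewrite expr_le1 ?enorm_ge0.
  move: (enorm v ^+ 2) (enorm w) => t e t1; have := ler_wpM2l c0 t1; lra.
Qed.

(** * Transposed congruences do not increase [eta] *)

Lemma symp_congr_tr (R : realType) n m (Z : 'M[R]_n) (X : 'M[R]_(n, m)) :
  symp (X^T *m Z^T *m X) = X^T *m symp Z *m X.
Proof.
rewrite /symp -scalemxAr -scalemxAl; congr (_ *: _).
by rewrite mulmxDr mulmxDl !trmx_mul !trmxK mulmxA addrC.
Qed.

Lemma antip_congr_tr (R : realType) n m (Z : 'M[R]_n) (X : 'M[R]_(n, m)) :
  antip (X^T *m Z^T *m X) = - (X^T *m antip Z *m X).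
Proof.
rewrite /antip -scalemxAr -scalemxAl -scalerN; congr (_ *: _).
by rewrite mulmxBr mulmxBl !trmx_mul !trmxK mulmxA opprB.
Qed.

Lemma posdefmx_symp_congr_tr (R : realType) n m (Z : 'M[R]_n) (X : 'M[R]_(n, m)) :
  (forall v : 'cV[R]_m, X *m v = 0 -> v = 0) ->
  posdefmx (symp Z) -> posdefmx (symp (X^T *m Z^T *m X)).
Proof. by move=> injX pdZ; rewrite symp_congr_tr; exact: posdefmx_congr. Qed.

Lemma eta_congr_tr_le (R : realType) n m (Z : 'M[R]_n) (X : 'M[R]_(n, m)) :
  (forall v : 'cV[R]_m, X *m v = 0 -> v = 0) ->
  posdefmx (symp Z) -> eta (X^T *m Z^T *m X) <= eta Z.
Proof.
move=> injX pdZ; have eta0 : 0 <= eta Z by exact: specnorm_ge0.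
apply/eta_leP => // [|x y]; first exact: posdefmx_symp_congr_tr.
(* The sign of the second test vector absorbs the sign that transposition puts on the antisymmetric
   part; the quadratic terms are unaffected. *)
have /eta_leP/(_ eta0)/iffLR/(_ (lexx _))/(_ (X *m x) (- (X *m y))) := pdZ.
have quadX (v : 'cV[R]_m) :
    (v^T *m (X^T *m Z^T *m X) *m v) 0 0 = ((X *m v)^T *m Z *m (X *m v)) 0 0.
  by rewrite [RHS]quad_tr trmx_mul !mulmxA.
by rewrite antip_congr_tr !quadX !trmxN !(mulNmx, mulmxN) opprK !trmx_mul !mulmxA.
Qed.

Lemma unitmx_symp_posdef (R : realType) n (Z : 'M[R]_n) :
  posdefmx (symp Z) -> Z \in unitmx.
Proof.
case=> _ posH; apply: unitmx_injP => v Zv0; apply/eqP/negPn/negP => /posH.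
by rewrite quad_symp -mulmxA Zv0 mulmx0 mxE ltxx.
Qed.

(** * Principal blocks of the inverse *)

Section InverseBlock.
Variables (R : realType) (n p : nat) (S : {set 'I_n}) (hS : #|S| = p).
Variable Z : 'M[R]_n.
Hypothesis pdZ : posdefmx (symp Z).

Let sel (i : 'I_p) : 'I_n := enum_val (cast_ord (esym hS) i).
Let Q : 'M[R]_(n, p) := colsub sel 1%:M.

Let Zu : Z \in unitmx := unitmx_symp_posdef pdZ.

Let trQ_Q : Q^T *m Q = 1%:M.
Proof.
have sel_inj : injective sel by apply: inj_comp enum_val_inj (@cast_ord_inj _ _ _).
have -> : Q^T = rowsub sel 1%:M by rewrite trmx_mxsub trmx1.
by rewrite -mxsub_mul mulmx1; apply/matrixP => i j; rewrite !mxE (inj_eq sel_inj).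
Qed.

Let blockE (A : 'M[R]_n) : block hS A = Q^T *m A *m Q.
Proof.
have -> : Q^T = rowsub sel 1%:M by rewrite trmx_mxsub trmx1.
by rewrite mul_rowsub_mx mul1mx -mxsub_mul mulmx1.
Qed.

Let block_invE : block hS (invmx Z) = (invmx Z *m Q)^T *m Z^T *m (invmx Z *m Q).
Proof.
rewrite blockE trmx_mul -!mulmxA; congr (_ *m _).
by rewrite trmx_inv mulKmx // unitmx_tr.
Qed.

Let invZ_Q_inj (v : 'cV[R]_p) : invmx Z *m Q *m v = 0 -> v = 0.
Proof.
(* [Q^T Z] is a left inverse of [Z^-1 Q], because [Q^T Q = 1]. *)
rewrite -mulmxA => /(congr1 (mulmx (Q^T *m Z))).
by rewrite mulmx0 -mulmxA mulKVmx // mulmxA trQ_Q mul1mx.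
Qed.

Lemma posdefmx_symp_block_inv : posdefmx (symp (block hS (invmx Z))).
Proof. by rewrite block_invE; exact: posdefmx_symp_congr_tr. Qed.

Lemma eta_block_inv_le : eta (block hS (invmx Z)) <= eta Z.
Proof. by rewrite block_invE; exact: eta_congr_tr_le. Qed.

Lemma eta_block_inv_full : S = [set: 'I_n]%SET -> eta (block hS (invmx Z)) = eta Z.
Proof.
move=> ST; have pn : p = n by rewrite -hS ST cardsT card_ord.
have Q_trQ : Q *m Q^T = 1%:M.
  (* Once [p] is replaced by [n], [Q] is square and its left inverse is also a right inverse. *)
  by move: Q trQ_Q; rewrite pn => Q' /mulmx1C.
have invQ (A : 'M[R]_n) : Q *m (Q^T *m A) = A by rewrite mulmxA Q_trQ mul1mx.
apply/eqP; rewrite eq_le eta_block_inv_le /=.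
(* The reverse inequality: [Z] is itself a transposed congruence of the block, through [Q^T Z],
   which has left inverse [Z^-1 Q]. *)
have {1}-> : Z = (Q^T *m Z)^T *m (block hS (invmx Z))^T *m (Q^T *m Z).
  rewrite blockE !trmx_mul !trmxK -!mulmxA !invQ trmx_inv.
  by rewrite mulKVmx // unitmx_tr.
apply: eta_congr_tr_le posdefmx_symp_block_inv => v /(congr1 (mulmx (invmx Z *m Q))).
by rewrite mulmx0 -!mulmxA (mulmxA Q) Q_trQ mul1mx mulKmx.
Qed.

End InverseBlock.

(** * The symmetric part of the stiffness matrix, and the network bound *)

Lemma symp_block (R : realType) n p (S : {set 'I_n}) (hS : #|S| = p)
  (A : 'M[R]_n) : symp (block hS A) = block hS (symp A).
Proof. by apply/matrixP => i j; rewrite !mxE. Qed.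

Lemma blockD (R : realType) n p (S : {set 'I_n}) (hS : #|S| = p)
  (A B : 'M[R]_n) : block hS (A + B) = block hS A + block hS B.
Proof. by apply/matrixP => i j; rewrite !mxE. Qed.

(** Bond by bond, [q q^T] is its own transpose, so only the odd term [s q^T] is changed by
    symmetrization. *)
Lemma symp_stiffness (R : realType) N nb (G : network R N nb) (k a : 'I_nb -> R) :
  symp (stiffness G k a) = stiffness G k (fun=> 0)
    + 2^-1 *: \sum_b a b *: (svec G b *m (qvec G b)^T + qvec G b *m (svec G b)^T).
Proof.
rewrite /symp /stiffness [(\sum_b _)^T]linear_sum /= -big_split /= !scaler_sumr.
rewrite -big_split /=; apply: eq_bigr => b _.
move: (qvec G b) (svec G b) => q s.
rewrite scale0r addr0 trmx_mul trmxK trmxD !trmxZ mulmxDl mulmxDr.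
rewrite -!scalemxAl -!scalemxAr.
move: (q *m q^T) (s *m q^T) (q *m s^T) => A B C.
by apply/matrixP => i j; rewrite !mxE; field.
Qed.

Theorem proposition18 (R : realType) (N nb : nat) (G : network R N nb)
    (k a : 'I_nb -> R) (hk : forall b, 0 < k b)
    (pinned : {set 'I_(N * 2)}) (hpin : #|pinned| = 3%N)
    (hrigid : removes_rigid G pinned)
    (p : nat) (P : {set 'I_(2 * N - 3)}) (hP : #|P| = p) :
  let Kff := restrict_free hpin (stiffness G k a) in
  let Ks := symp Kff in
  let Ka := antip Kff in
  let C := invmx Kff in
  let CP := block hP C in
  Ks = restrict_free hpin (stiffness G k (fun=> 0))
       + restrict_free hpin
           (2^-1 *: \sum_b a b *: (svec G b *m (qvec G b)^T
                                   + qvec G b *m (svec G b)^T))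
  /\ (posdefmx Ks ->
      [/\ Kff \in unitmx,
          posdefmx (symp CP),
          eta CP <= eta Kff
            /\ eta Kff = specnorm (invsqrtmx Ks *m Ka *m invsqrtmx Ks),
          P = [set: 'I_(2 * N - 3)]%SET -> eta CP = eta Kff
        & forall B : 'M[R]_p, CP = B -> eta B <= eta Kff]).
Proof.
move=> Kff Ks Ka C CP; split=> [|pdK].
  by rewrite /Ks /Kff /restrict_free symp_block symp_stiffness blockD.
split=> [||||B <-]; first exact: unitmx_symp_posdef.
- exact: posdefmx_symp_block_inv.
(* The remaining equality is the definition of [eta] and holds by conversion. *)
- by split; first exact: eta_block_inv_le.
- exact: eta_block_inv_full.
- exact: eta_block_inv_le.
Qed.
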